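(* In the linear-regression setting of the context, assume that: (i) $\mathbf{R}-\mathbf{R}_n\to\mathbf{0}$ a.s. and $\mathbf{r}-\mathbf{r}_n\to\mathbf{0}$ a.s.; (ii) $\mathbf{R}$ is non-singular; (iii) there exists $\varpi\in\mathbb{R}_{>0}$ such that $\varpi_n:=\varpi\ge\max\{\|\mathbf{R}\|,\|\mathbf{R}_n\|\}$ a.s. for all $n$; (iv) for every $(\mathbf{x}_*,\mathbf{v}_* )\in\Upsilon_*^{(\lambda)}$, with $\vartheta_n$ the corresponding random variables defined in the context, there exists a nonnegative random variable $\psi$ with $\mathbb{E}(\psi)<+\infty$ such that $\sum_n\max\{0,\mathbb{E}_{|\mathcal{F}_n}(\vartheta_n)\}\le\psi$ a.s.; (v) there exists $C_\pi>0$ such that $\mathbb{E}(\|\pi_n-\pi\|^2)\le C_\pi$ for all $n$. Then the set of cluster points of the sequence $(\mathbf{x}_n)_n$ generated by either HRLSa or HRLSb (see context; any $\alpha\in[0.5,1)$, $\lambda>0$) is nonempty, and any of its cluster points is a solution, a.s., of $$\min_{\mathbf{x}\in\mathbb{R}^D}\|\mathbf{x}\|_1\quad\text{subject to}\quad \mathbf{x}\in\arg\min_{\mathbf{x}'\in\mathbb{R}^D}\mathbb{E}\Big[\sum_{\nu=1}^n(\mathbf{a}_\nu^{\top}\mathbf{x}'-b_\nu)^2\Big].$$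
   Context: Setting: on a probability space, $b_n=\mathbf{a}_n^\top\boldsymbol\theta_*+\eta_n$ a.s. for all $n\in\mathbb{Z}_{>0}$, where $\boldsymbol\theta_*\in\mathbb{R}^D$, $(\mathbf{a}_n,b_n)\in\mathbb{R}^D\times\mathbb{R}$, and the noise $(\eta_n)_n$ is zero-mean and independent of $(\mathbf{a}_n)_n$. The quantities $\mathbf{R}:=\mathbb{E}(\mathbf{a}_n\mathbf{a}_n^\top)$, $\mathbf{r}:=\mathbb{E}(b_n\mathbf{a}_n)$ and $\mathbb{E}(b_n^2)$ do not depend on $n$; consequently the constraint set in the minimization problem is, for every $n$, $\mathcal{A}:=\{\mathbf{x}:\mathbf{R}\mathbf{x}=\mathbf{r}\}$. For $n\ge1$, $\mathbf{R}_n:=\frac1n\sum_{\nu=1}^n\mathbf{a}_\nu\mathbf{a}_\nu^\top$, $\mathbf{r}_n:=\frac1n\sum_{\nu=1}^n b_\nu\mathbf{a}_\nu$; $\mathbf{R}_0$ (symmetric positive semidefinite) and $\mathbf{r}_0$ are user-chosen initial values. $\|\cdot\|$ is the Euclidean/spectral norm. Mappings. For HRLSa: $T\mathbf{x}=Q\mathbf{x}+\pi$ with $Q=\mathbf{I}-\frac1\varpi\mathbf{R}$, $\pi=\frac1\varpi\mathbf{r}$, and $T_n\mathbf{x}=Q_n\mathbf{x}+\pi_n$ with $Q_n=\mathbf{I}-\frac1{\varpi_n}\mathbf{R}_n$, $\pi_n=\frac1{\varpi_n}\mathbf{r}_n$. For HRLSb, with fixed $\kappa>0$: $Q=(\mathbf{I}+\kappa\mathbf{R})^{-1}$,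 $\pi=\kappa(\mathbf{I}+\kappa\mathbf{R})^{-1}\mathbf{r}$, $Q_n=(\mathbf{I}+\kappa\mathbf{R}_n)^{-1}$, $\pi_n=\kappa(\mathbf{I}+\kappa\mathbf{R}_n)^{-1}\mathbf{r}_n$. Let $T_n^{(\alpha)}:=\alpha T_n+(1-\alpha)\mathrm{Id}$, let $g:=\|\cdot\|_1$, and let $\operatorname{Prox}_{\lambda g}$ be soft-thresholding: $[\operatorname{Prox}_{\lambda g}(\mathbf{x})]_d=[\mathbf{x}]_d(1-\lambda/\max\{\lambda,|[\mathbf{x}]_d|\})$, $d=1,\dots,D$. HRLSa/HRLSb: given $\mathbf{x}_0$, $\mathbf{x}_{1/2}:=T_0^{(\alpha)}\mathbf{x}_0$, $\mathbf{x}_1:=\operatorname{Prox}_{\lambda g}(\mathbf{x}_{1/2})$, and for $n\ge1$, $\mathbf{x}_{n+1/2}:=\mathbf{x}_{n-1/2}-T_{n-1}^{(\alpha)}\mathbf{x}_{n-1}+T_n\mathbf{x}_n$, $\mathbf{x}_{n+1}:=\operatorname{Prox}_{\lambda g}(\mathbf{x}_{n+1/2})$, with the respective choice of $T_n$. (For HRLSa this reads $\mathbf{x}_{1/2}=\mathbf{x}_0-\frac{\alpha}{\varpi_0}(\mathbf{R}_0\mathbf{x}_0-\mathbf{r}_0)$ and $\mathbf{x}_{n+1/2}=\mathbf{x}_n+\mathbf{x}_{n-1/2}-\mathbf{x}_{n-1}+\frac{\alpha}{\varpi_{n-1}}(\mathbf{R}_{n-1}\mathbf{x}_{n-1}-\mathbf{r}_{n-1})-\frac1{\varpi_n}(\mathbf{R}_n\mathbf{x}_n-\mathbf{r}_n)$.)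 $\mathcal{F}_n:=\sigma(\mathbf{x}_0,\dots,\mathbf{x}_n)$ and $\mathbb{E}_{|\mathcal{F}_n}$ is conditional expectation. $\boldsymbol\xi_n:=(\mathbf{x}_{n-1/2}-\mathbf{x}_n)/\lambda\in\partial g(\mathbf{x}_n)$, $n\ge1$. $U$ is the positive semidefinite square root of $\mathrm{Id}-Q$, and $\Upsilon_*^{(\lambda)}:=\{(\mathbf{x},\mathbf{v})\in\mathcal{A}\times\mathbb{R}^D:-U\mathbf{v}/\lambda\in\partial g(\mathbf{x})\}$. For $(\mathbf{x}_*,\mathbf{v}_* )\in\Upsilon_*^{(\lambda)}$ let $\boldsymbol\xi_*:=-U\mathbf{v}_*/\lambda$ and $$\begin{aligned}\vartheta_n:={}&2(1-2\alpha)\langle \mathbf{x}_{n+1}-\mathbf{x}_*|(T-T_{n+1})\mathbf{x}_{n+1}\rangle+2\alpha\langle \mathbf{x}_{n+1}-\mathbf{x}_*|(Q-Q_{n+1})(\mathbf{x}_{n+1}-\mathbf{x}_n)\rangle\\&+2\alpha\langle \mathbf{x}_{n+1}-\mathbf{x}_*|(T_n-T_{n+1})\mathbf{x}_n\rangle+2(1-\alpha)\langle \mathbf{x}_{n+1}-\mathbf{x}_*|\textstyle\sum_{\nu=1}^{n+1}(T_\nu-T)\mathbf{x}_\nu\rangle\\&+2\lambda\langle \mathbf{x}_*-\mathbf{x}_{n+1}|\boldsymbol\xi_{n+1}-\boldsymbol\xi_*\rangle.\end{aligned}$$ *)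

(* Defs.v *)
From HB Require Import structures.
From mathcomp Require Import all_boot all_order all_algebra.
From mathcomp Require Import all_classical all_reals all_analysis.

Set Implicit Arguments.
Unset Strict Implicit.
Unset Printing Implicit Defensive.

Import Order.TTheory GRing.Theory Num.Theory.
Import numFieldNormedType.Exports.

Local Open Scope classical_set_scope.
Local Open Scope ring_scope.

Section euclidean.
Context {R : realType} {D : nat}.
Implicit Types (x y u : 'cV[R]_D) (A : 'M[R]_D).

Definition dotp x y : R := \sum_(i < D) x i 0 * y i 0.

(* The library norm `|x| on matrices is the max-norm, hence these
   definitions; the induced topology is the same. *)
Definition norm2 x : R := Num.sqrt (dotp x x).
Definition norm1 x : R := \sum_(i < D) `|x i 0|.
Definition spectral_norm A : R := sup [set norm2 (A *m x) | x in [set x | norm2 x <= 1]].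

Definition psd A : Prop := A^T = A /\ forall x, 0 <= dotp x (A *m x).

(* The positive semidefinite square root (unique when it exists, which is the
   case when A itself is positive semidefinite). *)
Definition psd_sqrt A : 'M[R]_D := xget 0 [set V | psd V /\ V *m V = A].

Definition subdiff (f : 'cV[R]_D -> R) x : set 'cV[R]_D :=
  [set u | forall y, f x + dotp u (y - x) <= f y].

Definition soft_threshold (lambda : R) x : 'cV[R]_D :=
  \col_i (x i 0 * (1 - lambda / Num.max lambda `|x i 0|)).

End euclidean.

Definition argmin {X : Type} {disp : Order.disp_t} {Y : porderType disp}
    (f : X -> Y) (S : set X) : set X :=
  [set x | S x /\ forall y, S y -> (f x <= f y)%O].

Section sample_averages.
Context {R : realType} {D : nat}.
Variables (a : nat -> 'cV[R]_D) (b : nat -> R).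

Definition sample_R (R0 : 'M[R]_D) (n : nat) : 'M[R]_D :=
  if n is 0 then R0 else n%:R^-1 *: \sum_(1 <= k < n.+1) a k *m (a k)^T.

Definition sample_r (r0 : 'cV[R]_D) (n : nat) : 'cV[R]_D :=
  if n is 0 then r0 else n%:R^-1 *: \sum_(1 <= k < n.+1) b k *: a k.

End sample_averages.

Inductive hrls_variant := HRLSa | HRLSb.

Section hrls.
Context {R : realType} {D : nat}.

(* The linear part and the offset of the mappings T and T_n are obtained by
   taking (M, m) to be (R, r) and (R_n, r_n), respectively. *)
Definition hrls_Q (var : hrls_variant) (varpi kappa : R) (M : 'M[R]_D) : 'M[R]_D :=
  match var with
  | HRLSa => 1%:M - varpi^-1 *: M
  | HRLSb => invmx (1%:M + kappa *: M)
  end.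

Definition hrls_pi (var : hrls_variant) (varpi kappa : R)
    (M : 'M[R]_D) (m : 'cV[R]_D) : 'cV[R]_D :=
  match var with
  | HRLSa => varpi^-1 *: m
  | HRLSb => kappa *: (invmx (1%:M + kappa *: M) *m m)
  end.

Definition affine_map (Q : 'M[R]_D) (p x : 'cV[R]_D) : 'cV[R]_D := Q *m x + p.

Definition relax (alpha : R) (F : 'cV[R]_D -> 'cV[R]_D) (x : 'cV[R]_D) : 'cV[R]_D :=
  alpha *: F x + (1 - alpha) *: x.

Section iterates.
Variables (alpha lambda : R) (Tn : nat -> 'cV[R]_D -> 'cV[R]_D) (x0 : 'cV[R]_D).

(* The pair (x_n, x_{n+1/2}). *)
Fixpoint hrls_state (n : nat) : 'cV[R]_D * 'cV[R]_D :=
  if n is m.+1 then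
    let: (x, xhalf) := hrls_state m in
    let x' := soft_threshold lambda xhalf in
    (x', xhalf - relax alpha (Tn m) x + Tn m.+1 x')
  else (x0, relax alpha (Tn 0%N) x0).

Definition hrls_x (n : nat) : 'cV[R]_D := (hrls_state n).1.

(* hrls_xhalf n is x_{n+1/2}. *)
Definition hrls_xhalf (n : nat) : 'cV[R]_D := (hrls_state n).2.

(* Meaningful for n >= 1 only. *)
Definition hrls_xi (n : nat) : 'cV[R]_D :=
  lambda^-1 *: (hrls_xhalf n.-1 - hrls_x n).

End iterates.

(* The constraint set A is {x | M x = m}; psd_sqrt (Id - Q) is the positive
   semidefinite square root U of Id - Q. *)
Definition Upsilon (lambda : R) (Q M : 'M[R]_D) (m : 'cV[R]_D) :
    set ('cV[R]_D * 'cV[R]_D) :=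
  [set xv | M *m xv.1 = m /\
    subdiff norm1 xv.1 (- (lambda^-1 *: (psd_sqrt (1%:M - Q) *m xv.2)))].

Definition vartheta (alpha lambda : R)
    (Q : 'M[R]_D) (T : 'cV[R]_D -> 'cV[R]_D)
    (Qn : nat -> 'M[R]_D) (Tn : nat -> 'cV[R]_D -> 'cV[R]_D)
    (x xi : nat -> 'cV[R]_D) (xstar xistar : 'cV[R]_D) (n : nat) : R :=
  2 * (1 - 2 * alpha) * dotp (x n.+1 - xstar) (T (x n.+1) - Tn n.+1 (x n.+1))
  + 2 * alpha * dotp (x n.+1 - xstar) ((Q - Qn n.+1) *m (x n.+1 - x n))
  + 2 * alpha * dotp (x n.+1 - xstar) (Tn n (x n) - Tn n.+1 (x n))
  + 2 * (1 - alpha) * dotp (x n.+1 - xstar)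
      (\sum_(1 <= k < n.+2) (Tn k (x k) - T (x k)))
  + 2 * lambda * dotp (xstar - x n.+1) (xi n.+1 - xistar).

End hrls.

Section probability.
Context {R : realType} {d : measure_display} {Omega : measurableType d}.

Definition random_matrix {m n : nat} (X : Omega -> 'M[R]_(m, n)) : Prop :=
  forall i j, measurable_fun [set: Omega] (fun w => X w i j).

Definition sigma_family {I : Type} (K : set I) (X : I -> Omega -> R) :
    set (set Omega) :=
  <<s \bigcup_(i in K) preimage_set_system [set: Omega] (X i) measurable >>.

Definition sigma_vectors {D : nat} (K : set nat) (X : nat -> Omega -> 'cV[R]_D) :
    set (set Omega) :=
  sigma_family [set ki : nat * 'I_D | K ki.1] (fun ki w => X ki.1 w ki.2 0).

Variable P : probability Omega R.

Definition indep_sigma (F G : set (set Omega)) : Prop :=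
  forall A B, F A -> G B -> P (A `&` B) = (P A * P B)%E.

(* Z is one version of the conditional expectation of X given F; versions are
   a.s. equal, and integrability of X is part of being conditionable. *)
Definition is_cond_exp (F : set (set Omega)) (X Z : Omega -> R) : Prop :=
  [/\ P.-integrable [set: Omega] (EFin \o X),
      P.-integrable [set: Omega] (EFin \o Z),
      (forall B : set R, measurable B -> F (Z @^-1` B)) &
      forall A, F A -> (\int[P]_(w in A) (Z w)%:E = \int[P]_(w in A) (X w)%:E)%E].

Definition ls_loss {D : nat} (a : nat -> Omega -> 'cV[R]_D) (b : nat -> Omega -> R)
    (n : nat) (x : 'cV[R]_D) : \bar R :=
  'E_P[(fun w => \sum_(1 <= k < n.+1) (dotp (a k w) x - b k w) ^+ 2)%R]%E.

End probability.

(* Main.v *)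
Require Import Defs.
From HB Require Import structures.
From mathcomp Require Import all_boot all_order all_algebra.
From mathcomp Require Import all_classical all_reals all_analysis.

From mathcomp Require Import spectral complex measurable_realfun ring lra.

(** Since MR is nonsingular, the only feasible point is xstar = MR^-1 r, so the
    theorem amounts to x_n --> xstar almost surely, together with the fact that
    xstar is the unique minimiser of the expected loss.

    Let y_n = x_n - xstar, let U be the square root of 1 - Q, and let
    v_n = (1 - alpha) (U y_1 + ... + U y_n).  The recursion telescopes into
    x_{n+1} + lambda xi_{n+1} =
      alpha T_n x_n + (1 - alpha) x_n + (1 - alpha) sum_{k=1}^n (T_k x_k - x_k)
    ([hrls_xhalfE]).  Pairing it with 2 y_{n+1} turns it into an exact balance
    ([energy_identity]) for
      V_n = |y_n|^2 - alpha |U y_n|^2 + |v_n - vstar|^2 / (1 - alpha):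
      V_{n+1} + (3 alpha - 1) |U y_{n+1}|^2
        + (|y_{n+1} - y_n|^2 - alpha |U (y_{n+1} - y_n)|^2) = V_n + vartheta_n.
    Here vartheta_n collects the errors made in replacing the T_k by T and the
    monotonicity term - 2 lambda <y_{n+1}, xi_{n+1} - xistar>, whereas
    0 <= Q <= 1 makes V_n and the bracket nonnegative.

    It remains to integrate this balance ([drift_cvg0]).  The initial value x_0
    need not be integrable, so the integrals are taken over a sublevel set
    {V_0 <= M}.  This event depends on x_0 alone, hence lies in every F_n, and
    over it vartheta_n may be replaced by its conditional expectation.  Summing
    over n, the series of the integrals of (3 alpha - 1) |U y_{n+1}|^2 is at
    most M + E psi, so U y_n --> 0 a.s. on {V_0 <= M}; these events exhaust the
    space, and U is invertible.

    Two ingredients surround this argument: the square root U exists and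
    Upsilon is nonempty ([psd_sqrtP], [sign_subdiff]), and the expected loss is
    the quadratic n (<x, MR x> - 2 <x, r> + sb) ([ls_lossE]). *)

Set Implicit Arguments.
Unset Strict Implicit.
Unset Printing Implicit Defensive.

Import Order.TTheory GRing.Theory Num.Theory.
Import numFieldNormedType.Exports.

Local Open Scope classical_set_scope.
Local Open Scope ring_scope.

(** * Inner products and the positive semidefinite square root *)

Section dotp_theory.
Context {R : realType} {D : nat}.
Implicit Types (x y z : 'cV[R]_D) (A : 'M[R]_D).

Lemma dotpE x y : dotp x y = (x^T *m y) 0 0.
Proof. by rewrite !mxE; apply: eq_bigr => i _; rewrite mxE. Qed.

Lemma dotpC x y : dotp x y = dotp y x.
Proof. by apply: eq_bigr => i _; rewrite mulrC. Qed.

Lemma dotpDl x y z : dotp (x + y) z = dotp x z + dotp y z.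
Proof. by rewrite -big_split; apply: eq_bigr => i _; rewrite mxE mulrDl. Qed.

Lemma dotpZl c x y : dotp (c *: x) y = c * dotp x y.
Proof. by rewrite /dotp mulr_sumr; apply: eq_bigr => i _; rewrite mxE mulrA. Qed.

Lemma dotpDr x y z : dotp z (x + y) = dotp z x + dotp z y.
Proof. by rewrite dotpC dotpDl !(dotpC z). Qed.

Lemma dotpZr c x y : dotp y (c *: x) = c * dotp y x.
Proof. by rewrite dotpC dotpZl dotpC. Qed.

Lemma dotpNr x y : dotp x (- y) = - dotp x y.
Proof. by rewrite -scaleN1r dotpZr mulN1r. Qed.

Lemma dotpNl x y : dotp (- x) y = - dotp x y.
Proof. by rewrite -scaleN1r dotpZl mulN1r. Qed.

Lemma dotp_trmx A x y : dotp (A *m x) y = dotp x (A^T *m y).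
Proof. by rewrite !dotpE trmx_mul mulmxA. Qed.

Lemma dotp_sym A x y : A^T = A -> dotp (A *m x) y = dotp x (A *m y).
Proof. by move=> As; rewrite dotp_trmx As. Qed.

Lemma dotp_ge0 x : 0 <= dotp x x.
Proof. by apply: sumr_ge0 => i _; rewrite -expr2 sqr_ge0. Qed.

Lemma sqr_le_dotp x i : x i 0 ^+ 2 <= dotp x x.
Proof.
rewrite /dotp (bigD1 i) //= -expr2 lerDl.
by apply: sumr_ge0 => j _; rewrite -expr2 sqr_ge0.
Qed.

Lemma dotp_eq0 x : dotp x x = 0 -> x = 0.
Proof.
move=> x0; apply/matrixP => i j; rewrite ord1 mxE.
have := sqr_le_dotp x i; rewrite x0 => xi0.
by apply/eqP; rewrite -sqrf_eq0 eq_le xi0 sqr_ge0.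
Qed.

Lemma dotp_CS x y : dotp x y ^+ 2 <= dotp x x * dotp y y.
Proof.
have [y0|yn0] := eqVneq (dotp y y) 0.
  by rewrite (dotp_eq0 y0) -(scale0r (0 : 'cV[R]_D)) !dotpZr !mul0r mulr0 expr0n.
have yp : 0 < dotp y y by rewrite lt_neqAle eq_sym yn0 dotp_ge0.
(* this vector is <y, y> times the component of x orthogonal to y *)
have := dotp_ge0 (dotp y y *: x - dotp x y *: y).
rewrite !(dotpDl, dotpDr, dotpNl, dotpNr, dotpZl, dotpZr) (dotpC y x).
set a := dotp x x; set b := dotp x y; set c := dotp y y => h.
have {h} : 0 <= c * (a * c - b ^+ 2).
  apply: le_trans h _; rewrite le_eqVlt; apply/orP; left; apply/eqP.
  by ring.
by rewrite (pmulr_rge0 _ yp) subr_ge0.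
Qed.
End dotp_theory.

Lemma interpolation (F : fieldType) (s : seq F) (f : F -> F) :
  exists q : {poly F}, {in s, forall x, q.[x] = f x}.
Proof.
elim: s => [|a s [q qP]]; first by exists 0.
have [as_|nas] := boolP (a \in s).
  by exists q => x; rewrite inE => /predU1P[->|]; apply: qP.
pose p : {poly F} := \prod_(b <- s) ('X - b%:P).
have pa : p.[a] != 0 by rewrite -rootE root_prod_XsubC.
exists (q + ((f a - q.[a]) / p.[a]) *: p) => x; rewrite inE hornerD hornerZ.
move=> /predU1P[->|xs]; first by rewrite divfK // addrC subrK.
have /eqP-> : root p x by rewrite root_prod_XsubC.
by rewrite mulr0 addr0 qP.
Qed.

Lemma trmx_horner_mx (F : comNzRingType) n (A : 'M[F]_n.+1) (q : {poly F}) :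
  (horner_mx A q)^T = horner_mx A^T q.
Proof.
elim/poly_ind: q => [|q c IH]; first by rewrite !rmorph0 trmx0.
rewrite !rmorphD !rmorphM /= !horner_mx_X !horner_mx_C linearD /= tr_scalar_mx.
rewrite -!mulmxE trmx_mul IH; congr (_ + _).
by apply: comm_mx_horner; rewrite /comm_mx.
Qed.

Section psd_sqrt_theory.
Context {R : realType}.

(** The real symmetric case of the spectral theorem, with the diagonalisation
    left over the complex numbers: only its polynomial consequences are used,
    and these descend to the reals. *)
Lemma real_spectral n (A : 'M[R]_n) : A^T = A ->
  exists (P : 'M[R[i]]_n) (e : 'rV[R]_n), P \in unitmx /\
    map_mx (real_complex R) A =
      invmx P *m diag_mx (map_mx (real_complex R) e) *m P.
Proof.
move=> As; pose AC := map_mx (real_complex R) A.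
have ACr : AC \is a mxOver Num.real.
  by apply/mxOverP => i j; rewrite mxE complex_real.
have ACs : AC \is symmetricmx.
  by apply/is_hermitianmxP; rewrite expr0 scale1r map_mx_id // /AC map_trmx As.
have ACh := realsym_hermsym ACs ACr.
exists (spectralmx AC), (map_mx (@complex.Re R) (spectral_diag AC)).
split; first exact: spectral_unit.
apply: etrans (orthomx_spectralP (hermitian_normalmx ACh)) _.
congr (_ *m diag_mx _ *m _); apply/matrixP => i j; rewrite !mxE.
by rewrite RRe_real //; apply: (mxOverP (hermitian_spectral_diag_real ACh)).
Qed.

Lemma psd_eigenvalue_ge0 n (A : 'M[R]_n) c : psd A -> eigenvalue A c -> 0 <= c.
Proof.
move=> [As A0] /eigenvalueP[v vA v0].
have Av : A *m v^T = c *: v^T by rewrite -[A]trmxK -trmx_mul As vA linearZ.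
have vv : 0 < dotp v^T v^T.
  rewrite lt_neqAle dotp_ge0 andbT eq_sym; apply: contra_neq v0 => /dotp_eq0.
  by move/(congr1 trmx); rewrite trmxK trmx0.
by have := A0 v^T; rewrite Av dotpZr pmulr_lge0.
Qed.

(** The root is W = q(A), where the real polynomial q takes the value c^(1/4) at
    each eigenvalue c of A: being a polynomial in A it is real and symmetric,
    and W^4 = A can be checked on the diagonalisation.  A fourth root, rather
    than a square root, makes the positivity of W^2 immediate. *)
Lemma psd_fourth_root n (A : 'M[R]_n) : psd A ->
  exists W : 'M[R]_n, W^T = W /\ W *m W *m (W *m W) = A.
Proof.
case: n A => [|n] A Apsd.
  by exists 0; split; apply/matrixP => -[].
have As := Apsd.1; have [P [e [uP AE]]] := real_spectral As.
have e0 i : 0 <= e 0 i.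
  apply: (psd_eigenvalue_ge0 Apsd).
  rewrite -(eigenvalue_map (real_complex R)); apply/eigenvalueP.
  exists (row i P); last first.
    apply: contraTneq uP => rP0; apply/negP => /mulmxV/(congr1 (row i)).
    rewrite row_mul rP0 mul0mx => /matrixP/(_ 0 i); rewrite !mxE eqxx => /eqP.
    by rewrite eq_sym oner_eq0.
  rewrite AE !mulmxA -row_mul mulmxV // row1 -rowE row_diag_mx -scalemxAl -rowE.
  by rewrite mxE.
have [q qE] := interpolation [seq e 0 i | i <- enum 'I_n.+1]
  (fun c => Num.sqrt (Num.sqrt c)).
have {}qE i : q.[e 0 i] ^+ 4 = e 0 i.
  rewrite qE; last by apply: map_f; rewrite mem_enum.
  by rewrite (exprM _ 2 2) !sqr_sqrtr ?sqrtr_ge0.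
exists (horner_mx A q); split; first by rewrite trmx_horner_mx As.
have -> : horner_mx A q *m horner_mx A q *m (horner_mx A q *m horner_mx A q) =
    horner_mx A (q ^+ 4).
  by rewrite (exprM _ 2 2) !expr2 !rmorphM.
apply: (@map_mx_inj _ _ (real_complex R)).
rewrite map_horner_mx AE horner_mx_uconjC // horner_mx_diag.
congr (_ *m diag_mx _ *m _); apply/matrixP => i j; rewrite !mxE.
by rewrite horner_map !ord1 /= horner_exp qE.
Qed.

(** With W from [psd_fourth_root], V = W^2 is a positive semidefinite square root, because
    <x, W^2 x> = |W x|^2. *)
Lemma psd_sqrtP n (A : 'M[R]_n) : psd A ->
  psd (psd_sqrt A) /\ psd_sqrt A *m psd_sqrt A = A.
Proof.
move=> /psd_fourth_root[W [Ws WA]].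
suff h : [set V | psd V /\ V *m V = A] (W *m W) by exact: (xgetI _ h).
split=> //; split=> [|x]; first by rewrite trmx_mul Ws.
by rewrite -mulmxA -(dotp_sym _ _ Ws) dotp_ge0.
Qed.

End psd_sqrt_theory.

(** * Spectral bounds for the fixed-point map *)

Section spectral_norm.
Context {R : realType} {D : nat}.
Implicit Types (x z : 'cV[R]_D) (A : 'M[R]_D).

Lemma dotp_mulmx_le A x :
  dotp (A *m x) (A *m x) <= (\sum_i dotp (row i A)^T (row i A)^T) * dotp x x.
Proof.
rewrite mulr_suml; apply: ler_sum => i _; rewrite -expr2.
have -> : (A *m x) i 0 = dotp (row i A)^T x.
  by rewrite mxE; apply: eq_bigr => j _; rewrite !mxE.
exact: dotp_CS.
Qed.

Lemma norm2_mulmx_le A z : norm2 (A *m z) <= spectral_norm A * norm2 z.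
Proof.
have [z0|zn0] := eqVneq (dotp z z) 0.
  rewrite (dotp_eq0 z0) mulmx0 /norm2 (_ : dotp _ _ = 0) ?sqrtr0 ?mulr0 //.
  by apply: big1 => i _; rewrite mxE mul0r.
have zp : 0 < norm2 z by rewrite sqrtr_gt0 lt_neqAle eq_sym zn0 dotp_ge0.
have norm2Z (c : R) (y : 'cV[R]_D) : 0 <= c -> norm2 (c *: y) = c * norm2 y.
  move=> c0; rewrite /norm2 dotpZl dotpZr mulrA -expr2 sqrtrM ?sqr_ge0 //.
  by rewrite sqrtr_sqr ger0_norm.
rewrite -ler_pdivrMr // mulrC -norm2Z ?invr_ge0 ?sqrtr_ge0 // scalemxAr.
apply: ub_le_sup; last first.
  exists ((norm2 z)^-1 *: z) => //=.
  by rewrite norm2Z ?invr_ge0 ?sqrtr_ge0 // mulVf // gt_eqF.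
(* the Frobenius norm bounds the set whose supremum is the spectral norm *)
exists (Num.sqrt (\sum_i dotp (row i A)^T (row i A)^T)) => _ [x /= x1 <-].
rewrite ler_sqrt; last by apply: sumr_ge0 => i _; exact: dotp_ge0.
apply: le_trans (dotp_mulmx_le A x) _.
rewrite ler_piMr //; first by apply: sumr_ge0 => i _; exact: dotp_ge0.
by rewrite -(sqr_sqrtr (dotp_ge0 x)) expr_le1 // sqrtr_ge0.
Qed.

Lemma dotp_mulmx_le_spectral A z : dotp z (A *m z) <= spectral_norm A * dotp z z.
Proof.
apply: (@le_trans _ _ (norm2 z * norm2 (A *m z))).
  apply: le_trans (ler_norm _) _; rewrite -sqrtr_sqr -sqrtrM ?dotp_ge0 //.
  by rewrite ler_sqrt ?dotp_CS // mulr_ge0 ?dotp_ge0.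
rewrite -[in leRHS](sqr_sqrtr (dotp_ge0 z)) expr2 mulrA mulrC.
by rewrite ler_wpM2r ?sqrtr_ge0 // norm2_mulmx_le.
Qed.

Lemma unitmx_ker0 A : (forall z, A *m z = 0 -> z = 0) -> A \in unitmx.
Proof.
move=> kerA; rewrite -unitmx_tr -row_free_unit -kermx_eq0.
apply/rowV0P => v /sub_kermxP vA.
have /kerA /(congr1 trmx) : A *m v^T = 0 by rewrite -[A]trmxK -trmx_mul vA trmx0.
by rewrite trmxK trmx0.
Qed.
End spectral_norm.

Section fixed_point_map.
Context {R : realType} {D : nat}.
Variables (var : hrls_variant) (varpi kappa : R) (M : 'M[R]_D).
Hypotheses (Mpsd : psd M) (uM : M \in unitmx) (varpi0 : 0 < varpi)
  (Mvarpi : spectral_norm M <= varpi) (kappa0 : 0 < kappa).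
Local Notation Q := (hrls_Q var varpi kappa M).
Local Notation B := (1%:M + kappa *: M).

Lemma resolvent_unit : B \in unitmx.
Proof.
apply: unitmx_ker0 => z Bz; apply: dotp_eq0; apply/eqP; rewrite eq_le dotp_ge0 andbT.
have : dotp z (B *m z) = 0 by rewrite Bz; apply: big1 => i _; rewrite mxE mulr0.
rewrite mulmxDl mul1mx -scalemxAl dotpDr dotpZr => /eqP.
rewrite addr_eq0 => /eqP ->; rewrite oppr_le0 mulr_ge0 ?Mpsd.2 //; exact: ltW.
Qed.

Lemma resolvent_sym : (invmx B)^T = invmx B.
Proof. by rewrite trmx_inv linearD linearZ /= trmx1 Mpsd.1. Qed.

Lemma one_sub_resolvent : 1%:M - invmx B = (kappa *: M) *m invmx B.
Proof.
by rewrite -[X in X - _](mulmxV resolvent_unit) mulmxDl mul1mx addrC addKr.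
Qed.

(** For the resolvent, <z, B^-1 z> = <B u, u> with u = B^-1 z. *)
Lemma hrls_Q_ge0 z : 0 <= dotp z (Q *m z).
Proof.
case: var => /=.
  rewrite mulmxBl mul1mx -scalemxAl dotpDr dotpNr dotpZr subr_ge0.
  rewrite ler_pdivrMl //; apply: le_trans (dotp_mulmx_le_spectral _ _) _.
  by rewrite ler_wpM2r ?dotp_ge0.
rewrite -{1}(mulKVmx resolvent_unit z); set u := invmx B *m z.
rewrite mulmxDl mul1mx -scalemxAl dotpDl dotpZl dotpC addr_ge0 ?dotp_ge0 //.
by rewrite mulr_ge0 ?Mpsd.2 // ltW.
Qed.

Lemma one_sub_hrls_Q_psd : psd (1%:M - Q).
Proof.
case: var => /=.
  rewrite opprB addrC subrK; split; first by rewrite linearZ /= Mpsd.1.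
  by move=> z; rewrite -scalemxAl dotpZr mulr_ge0 ?Mpsd.2 // invr_ge0 ltW.
split; first by rewrite linearB /= trmx1 resolvent_sym.
move=> z; rewrite one_sub_resolvent -mulmxA -{1}(mulKVmx resolvent_unit z).
set u := invmx B *m z; rewrite mulmxDl mul1mx -scalemxAl dotpDl.
by rewrite addr_ge0 ?dotp_ge0 // dotpZr mulr_ge0 ?Mpsd.2 // ltW.
Qed.

Lemma one_sub_hrls_Q_unit : 1%:M - Q \in unitmx.
Proof.
case: var => /=.
  by rewrite opprB addrC subrK unitmxZ // unitfE invr_eq0 gt_eqF.
rewrite one_sub_resolvent unitmx_mul unitmx_inv resolvent_unit andbT.
by rewrite unitmxZ // unitfE gt_eqF.
Qed.

Lemma hrls_fixed_point (m xstar : 'cV[R]_D) : M *m xstar = m ->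
  affine_map Q (hrls_pi var varpi kappa M m) xstar = xstar.
Proof.
move=> <-; rewrite /affine_map; case: var => /=.
  by rewrite mulmxBl mul1mx -scalemxAl subrK.
rewrite scalemxAr scalemxAl -mulmxDr -{1}[xstar]mul1mx -mulmxDl mulKmx //.
exact: resolvent_unit.
Qed.
End fixed_point_map.

(** * Subgradients and limits *)

Section limits.
Context {R : realType} {D : nat}.

Lemma sign_subdiff (x : 'cV[R]_D) : subdiff norm1 x (\col_i Num.sg (x i 0)).
Proof.
move=> y; rewrite /norm1 /dotp -big_split /=; apply: ler_sum => i _.
rewrite !mxE mulrBr -normrEsg addrC subrK.
apply: le_trans (ler_norm _) _; rewrite normrM.
by rewrite ler_piMl // normr_sg; case: eqP.
Qed.

(** Vectors of dimension 0 are allowed, so the product topology is used directly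
    instead of a norm. *)
Lemma cvg_coord (x : nat -> 'cV[R]_D) (xstar : 'cV[R]_D) :
  (forall i, x n i 0 @[n --> \oo] --> xstar i 0) -> x n @[n --> \oo] --> xstar.
Proof.
move=> xi A [B nB BA]; rewrite /nbhs /=.
have : \forall n \near \oo, forall i, B i 0 (x n i 0).
  by apply: filter_forall => i; exact: xi (nB i 0).
by apply: filterS => n Bn; apply: BA => i j; rewrite ord1.
Qed.

Lemma cluster_cvg_eq (x : nat -> 'cV[R]_D) (xstar : 'cV[R]_D) :
  x n @[n --> \oo] --> xstar -> cluster (x n @[n --> \oo]) = [set xstar].
Proof.
move=> xx; apply/seteqP; split=> [z zc|_ ->]; last first.
  by move=> A B xA /xx xB; have [n [? ?]] := filter_ex (filterI xA xB); exists n.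
apply/matrixP => i j; rewrite ord1.
apply: (@norm_hausdorff R R) => A B zA xB.
have nA : nbhs z (fun y : 'cV[R]_D => A (y i 0)) by exact: coord_continuous zA.
have nB : nbhs xstar (fun y : 'cV[R]_D => B (y i 0)) by exact: coord_continuous xB.
by have [y [yB yA]] := zc _ _ (xx _ nB) nA; exists (y i 0).
Qed.

Lemma cvg_of_quadratic (U : 'M[R]_D) (x : nat -> 'cV[R]_D) (xstar : 'cV[R]_D) :
  U \in unitmx ->
  dotp (U *m (x n - xstar)) (U *m (x n - xstar)) @[n --> \oo] --> 0 ->
  x n @[n --> \oo] --> xstar.
Proof.
move=> uU Ux; apply: cvg_coord => i.
have coordU j : (U *m (x n - xstar)) j 0 @[n --> \oo] --> (0 : R).
  apply/norm_cvg0P.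
  have : Num.sqrt (dotp (U *m (x n - xstar)) (U *m (x n - xstar)))
      @[n --> \oo] --> (0 : R).
    by rewrite -[X in _ --> X]sqrtr0; apply: continuous_cvg => //; exact: sqrt_continuous.
  apply: (@squeeze_cvgr _ _ _ _ (cst 0)); last exact: cvg_cst.
  by near=> n; rewrite normr_ge0 -sqrtr_sqr ler_wsqrtr // sqr_le_dotp.
suff : (x n - xstar) i 0 + xstar i 0 @[n --> \oo] --> 0 + xstar i 0.
  by rewrite add0r; apply: cvg_trans; apply: near_eq_cvg; near=> n; rewrite !mxE subrK.
apply: cvgD; last exact: cvg_cst.
have -> : (fun n => (x n - xstar) i 0) =
    (fun n => \sum_j (invmx U) i j * (U *m (x n - xstar)) j 0).
  by apply/funext => n; rewrite -[in LHS](mulKmx uU (x n - xstar)) mxE.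
rewrite -[X in _ --> X](_ : \sum_j (invmx U) i j * 0 = 0); last first.
  by apply: big1 => j _; rewrite mulr0.
apply: (cvg_big (op := +%R)) => [|j _]; [exact: add_continuous|].
by apply: cvgM => //; exact: cvg_cst.
Unshelve. all: by end_near. Qed.
End limits.

(** * Energy balance of the iterates *)

Section energy_def.
Context {R : realType} {D : nat}.
Variables (alpha : R) (U : 'M[R]_D) (xstar vstar : 'cV[R]_D) (x : nat -> 'cV[R]_D).

Definition dual_var n : 'cV[R]_D :=
  (1 - alpha) *: \sum_(1 <= k < n.+1) U *m (x k - xstar).

(** The first two terms are the squared length of y for the matrix
    1 - alpha U^2, which is alpha Q + (1 - alpha) when U^2 = 1 - Q. *)
Definition energy n : R :=
  let y := x n - xstar in let u := dual_var n - vstar in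
  dotp y y - alpha * dotp (U *m y) (U *m y) + (1 - alpha)^-1 * dotp u u.

Lemma energy_ge0 n : 0 <= alpha < 1 ->
  (forall z, dotp (U *m z) (U *m z) <= dotp z z) -> 0 <= energy n.
Proof.
move=> /andP[al0 al1] UleI; apply: addr_ge0; last first.
  by rewrite mulr_ge0 ?dotp_ge0 // invr_ge0 subr_ge0 ltW.
rewrite subr_ge0; apply: le_trans (UleI _).
by rewrite ler_piMl ?dotp_ge0 // ltW.
Qed.
End energy_def.

Section energy.
Context {R : realType} {D : nat}.
Variables (alpha lambda : R) (Q U : 'M[R]_D) (p : 'cV[R]_D).
Variables (Tn : nat -> 'cV[R]_D -> 'cV[R]_D).
Variables (Qn : nat -> 'M[R]_D) (pn : nat -> 'cV[R]_D).
Variables (x0 xstar vstar : 'cV[R]_D).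
Local Notation T := (affine_map Q p).
Local Notation x := (hrls_x alpha lambda Tn x0).
Local Notation xhalf := (hrls_xhalf alpha lambda Tn x0).
Local Notation xi := (hrls_xi alpha lambda Tn x0).

Lemma hrls_xhalfS n :
  xhalf n.+1 = xhalf n - relax alpha (Tn n) (x n) + Tn n.+1 (x n.+1).
Proof. by rewrite /hrls_xhalf /hrls_x /=; case: hrls_state. Qed.

Lemma hrls_xS n : x n.+1 = soft_threshold lambda (xhalf n).
Proof. by rewrite /hrls_xhalf /hrls_x /=; case: hrls_state. Qed.

(** The memory term of the recursion accumulates residuals: step n subtracts the
    relaxed value at x_n but adds the unrelaxed one T_{n+1} x_{n+1}, whose excess
    over the relaxed value is (1 - alpha) (T_{n+1} x_{n+1} - x_{n+1}). *)
Lemma hrls_xhalfE n :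
  xhalf n = relax alpha (Tn n) (x n) +
    (1 - alpha) *: \sum_(1 <= k < n.+1) (Tn k (x k) - x k).
Proof.
elim: n => [|n IH]; first by rewrite big_geq // scaler0 addr0.
rewrite hrls_xhalfS IH [in RHS]big_nat_recr // /relax.
move: (x n.+1) (x n) (Tn n.+1 _) (Tn n _) => y z y1 z1.
by apply/matrixP => i j; rewrite !mxE; ring.
Qed.

Local Notation dual_var := (dual_var alpha U xstar x).
Local Notation energy := (energy alpha U xstar vstar x).

(** In terms of U, T z = z - U^2 (z - xstar), so that the accumulated residuals
    of T add up to - U v_{n+1} after multiplication by 1 - alpha; the remaining
    terms of [hrls_xhalfE] are errors T_k - T, which go into vartheta together
    with the term in xi - xistar.  As v_{n+1} - v_n = (1 - alpha) U y',
    the cross term 2 <U y', v_{n+1} - vstar> is the increment of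
    |v_n - vstar|^2 / (1 - alpha) up to (1 - alpha) |U y'|^2. *)
Lemma energy_identity n :
  (forall k z, Tn k z = affine_map (Qn k) (pn k) z) ->
  alpha != 1 -> lambda != 0 -> U^T = U -> U *m U = 1%:M - Q -> T xstar = xstar ->
  let y := x n - xstar in let y' := x n.+1 - xstar in
  energy n.+1 + ((3 * alpha - 1) * dotp (U *m y') (U *m y') +
    (dotp (y' - y) (y' - y) - alpha * dotp (U *m (y' - y)) (U *m (y' - y)))) =
  energy n + vartheta alpha lambda Q T Qn Tn x xi xstar
    (- (lambda^-1 *: (U *m vstar))) n.
Proof.
move=> TnE al1 l0 Us UU Tx y y'.
have TE z : T z = z - U *m (U *m (z - xstar)).
  have pE : p = xstar - Q *m xstar by rewrite -{1}Tx /affine_map addrC addKr.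
  rewrite mulmxA UU mulmxBl mul1mx mulmxBr /affine_map pE.
  by apply/matrixP => i j; rewrite !mxE; ring.
have xE : x n.+1 = y' + xstar by rewrite subrK.
have yE : x n = y + xstar by rewrite subrK.
set S := \sum_(1 <= k < n.+1) (Tn k (x k) - x k).
have dE : \sum_(1 <= k < n.+2) (Tn k (x k) - T (x k)) =
    S + (Tn n.+1 (x n.+1) - x n.+1) +
    \sum_(1 <= k < n.+2) U *m (U *m (x k - xstar)).
  rewrite -[S + _](@big_nat_recr _ _ _ n.+1 1 (fun k => Tn k (x k) - x k)) //.
  rewrite -big_split; apply: eq_bigr => k _ /=.
  by rewrite TE opprB addrA addrAC.
have vE : dual_var n.+1 = dual_var n + (1 - alpha) *: (U *m y').
  by rewrite /dual_var big_nat_recr //= scalerDr.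
(* symmetry of U moves one factor onto y' and leaves v_{n+1} *)
have UvE : (1 - alpha) * dotp y' (\sum_(1 <= k < n.+2) U *m (U *m (x k - xstar)))
    = dotp (U *m y') (dual_var n.+1).
  by rewrite (dotp_sym _ _ Us) /dual_var -scalemxAr dotpZr mulmx_sumr.
(* the difference of two affine maps has linear part Q - Qn *)
have t2 : (Q - Qn n.+1) *m (x n.+1 - x n) =
    (T (x n.+1) - Tn n.+1 (x n.+1)) - (T (x n) - Tn n.+1 (x n)).
  rewrite !TnE /affine_map mulmxBl !mulmxBr.
  by apply/matrixP => i j; rewrite !mxE; ring.
have xiE : lambda *: (xi n.+1 + lambda^-1 *: (U *m vstar)) =
    relax alpha (Tn n) (x n) + (1 - alpha) *: S - x n.+1 + U *m vstar.
  by rewrite /hrls_xi /= hrls_xhalfE scalerDr !scalerA divff // !scale1r.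
rewrite /vartheta t2 dE opprK.
have -> : 2 * lambda * dotp (xstar - x n.+1) (xi n.+1 + lambda^-1 *: (U *m vstar)) =
    - (2 * dotp y' (relax alpha (Tn n) (x n) + (1 - alpha) *: S - x n.+1 + U *m vstar)).
  by rewrite -xiE dotpZr -opprB -/y' dotpNl; ring.
rewrite /energy -/y -/y' vE !TE.
have {}UvE : 2 * (1 - alpha) * dotp y' (\sum_(1 <= k < n.+2) U *m (U *m (x k - xstar)))
    = 2 * dotp (U *m y') (dual_var n + (1 - alpha) *: (U *m y')).
  by rewrite -mulrA UvE vE.
rewrite (dotpDr (S + _)) (mulrDr _ _ (dotp _ (\sum_(_ <= _ < _) _))) UvE -/y -/y' /relax.
clearbody S; move: (dual_var n) (Tn n _) (Tn n.+1 (x n.+1)) (Tn n.+1 (x n)) xE yE.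
move=> v t t1 t2' xE yE; clearbody y y'.
rewrite {}xE {}yE mulmxBr.
rewrite !(dotpDl, dotpDr, dotpNl, dotpNr, dotpZl, dotpZr) !(dotp_sym _ _ Us).
have UUC : dotp y (U *m (U *m y')) = dotp y' (U *m (U *m y)).
  by rewrite -(dotp_sym y _ Us) dotpC (dotp_sym y' _ Us).
rewrite UUC (dotpC y y') -!(dotpC (U *m y')) !(dotp_sym _ _ Us) (dotpC v vstar).
by field; rewrite subr_eq0 eq_sym.
Qed.

End energy.

(** * Measurability of the iterates *)

Section measurability.
Context {R : realType} {d : measure_display} {Omega : measurableType d}.
Implicit Types m n : nat.

(** The reciprocal is x times the power function (x^2)^(-1), with no case split:
    both sides vanish at x = 0. *)
Lemma measurable_fun_invr (f : Omega -> R) :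
  measurable_fun [set: Omega] f -> measurable_fun [set: Omega] (fun w => (f w)^-1).
Proof.
move=> mf.
have -> : (fun w => (f w)^-1) = f \* (fun w => (f w ^+ 2) `^ (-1)).
  apply/funext => w /=; rewrite powR_inv1 ?sqr_ge0 //.
  have [->|f0] := eqVneq (f w) 0; first by rewrite invr0 mul0r.
  by rewrite expr2 invfM mulVKf.
apply: measurable_funM => //.
by apply: (measurableT_comp (measurable_powR (-1))); exact: measurable_funX.
Qed.

Lemma random_matrix_cst m n (A : 'M[R]_(m, n)) : random_matrix (fun _ : Omega => A).
Proof. by move=> i j; exact: measurable_cst. Qed.

Lemma random_matrixD m n (X Y : Omega -> 'M[R]_(m, n)) :
  random_matrix X -> random_matrix Y -> random_matrix (fun w => X w + Y w).
Proof.
move=> mX mY i j; under eq_fun do rewrite mxE.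
exact: measurable_funD.
Qed.

Lemma random_matrixZ m n (c : Omega -> R) (X : Omega -> 'M[R]_(m, n)) :
  measurable_fun [set: Omega] c -> random_matrix X ->
  random_matrix (fun w => c w *: X w).
Proof.
move=> mc mX i j; under eq_fun do rewrite mxE.
exact: measurable_funM.
Qed.

Lemma random_matrixN m n (X : Omega -> 'M[R]_(m, n)) :
  random_matrix X -> random_matrix (fun w => - X w).
Proof.
move=> mX i j; under eq_fun do rewrite mxE.
exact: measurable_funN.
Qed.

Lemma random_matrixB m n (X Y : Omega -> 'M[R]_(m, n)) :
  random_matrix X -> random_matrix Y -> random_matrix (fun w => X w - Y w).
Proof. by move=> mX mY; apply: random_matrixD => //; exact: random_matrixN. Qed.

Lemma random_matrix_sum m n I (s : seq I) (X : I -> Omega -> 'M[R]_(m, n)) :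
  (forall i, random_matrix (X i)) -> random_matrix (fun w => \sum_(i <- s) X i w).
Proof.
move=> mX i j; under eq_fun do rewrite summxE.
by apply: measurable_sum => k; exact: mX.
Qed.

Lemma random_matrixM m n p (X : Omega -> 'M[R]_(m, n)) (Y : Omega -> 'M[R]_(n, p)) :
  random_matrix X -> random_matrix Y -> random_matrix (fun w => X w *m Y w).
Proof.
move=> mX mY i j; under eq_fun do rewrite mxE.
by apply: measurable_sum => k; apply: measurable_funM; [exact: mX|exact: mY].
Qed.

Lemma random_matrix_tr m n (X : Omega -> 'M[R]_(m, n)) :
  random_matrix X -> random_matrix (fun w => (X w)^T).
Proof. by move=> mX i j; under eq_fun do rewrite mxE; exact: mX. Qed.

Lemma measurable_dotp n (X Y : Omega -> 'cV[R]_n) :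
  random_matrix X -> random_matrix Y ->
  measurable_fun [set: Omega] (fun w => dotp (X w) (Y w)).
Proof.
by move=> mX mY; apply: measurable_sum => k; exact: measurable_funM.
Qed.

Lemma measurable_det n (X : Omega -> 'M[R]_n) :
  random_matrix X -> measurable_fun [set: Omega] (fun w => \det (X w)).
Proof.
move=> mX; apply: measurable_sum => s.
apply: measurable_funM; first exact: measurable_cst.
by apply: measurable_prod => i _; exact: mX.
Qed.

Lemma random_matrix_inv n (X : Omega -> 'M[R]_n) :
  random_matrix X -> random_matrix (fun w => invmx (X w)).
Proof.
move=> mX i j.
have -> : (fun w => invmx (X w) i j) = (fun w => if \det (X w) == 0 then X w i j
    else (\det (X w))^-1 * cofactor (X w) j i).
  apply/funext => w; rewrite /invmx unitmxE unitfE; case: eqP => //= _.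
  by rewrite !mxE.
apply: measurable_fun_ifT => //.
  by apply: measurable_fun_eqr; [exact: measurable_det|exact: measurable_cst].
apply: measurable_funM; first by apply: measurable_fun_invr; exact: measurable_det.
apply: measurable_funM; first exact: measurable_cst.
apply: measurable_det => k l; under eq_fun do rewrite !mxE.
exact: mX.
Qed.

Lemma random_soft_threshold n lambda (X : Omega -> 'cV[R]_n) :
  random_matrix X -> random_matrix (fun w => soft_threshold lambda (X w)).
Proof.
move=> mX i j; under eq_fun do rewrite mxE.
apply: measurable_funM; first exact: mX.
apply: measurable_funB; first exact: measurable_cst.
apply: measurable_funM; first exact: measurable_cst.
apply: measurable_fun_invr; apply: measurable_maxr; first exact: measurable_cst.
by apply: (measurableT_comp (f := @Num.norm R R)) => //; exact: mX.
Qed.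

Section hrls_measurability.
Context {D : nat}.

Lemma random_sample_R (a : nat -> Omega -> 'cV[R]_D) (R0 : Omega -> 'M[R]_D) n :
  (forall k, random_matrix (a k)) -> random_matrix R0 ->
  random_matrix (fun w => sample_R (a ^~ w) (R0 w) n).
Proof.
move=> ma mR0; case: n => [//|n] /=.
apply: random_matrixZ; first exact: measurable_cst.
apply: random_matrix_sum => k; apply: random_matrixM => //.
exact: random_matrix_tr.
Qed.

Lemma random_sample_r (a : nat -> Omega -> 'cV[R]_D) (b : nat -> Omega -> R)
    (r0 : Omega -> 'cV[R]_D) n :
  (forall k, random_matrix (a k)) ->
  (forall k, measurable_fun [set: Omega] (b k)) -> random_matrix r0 ->
  random_matrix (fun w => sample_r (a ^~ w) (b ^~ w) (r0 w) n).
Proof.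
move=> ma mb mr0; case: n => [//|n] /=.
apply: random_matrixZ; first exact: measurable_cst.
by apply: random_matrix_sum => k; apply: random_matrixZ.
Qed.

Lemma random_hrls_Q var varpi kappa (M : Omega -> 'M[R]_D) :
  random_matrix M -> random_matrix (fun w => hrls_Q var varpi kappa (M w)).
Proof.
move=> mM; case: var => /=.
  apply: random_matrixB; first exact: random_matrix_cst.
  by apply: random_matrixZ => //; exact: measurable_cst.
apply: random_matrix_inv; apply: random_matrixD; first exact: random_matrix_cst.
by apply: random_matrixZ => //; exact: measurable_cst.
Qed.

Lemma random_hrls_pi var varpi kappa (M : Omega -> 'M[R]_D) (m : Omega -> 'cV[R]_D) :
  random_matrix M -> random_matrix m ->
  random_matrix (fun w => hrls_pi var varpi kappa (M w) (m w)).
Proof.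
move=> mM mm; case: var => /=.
  by apply: random_matrixZ => //; exact: measurable_cst.
apply: random_matrixZ; first exact: measurable_cst.
apply: random_matrixM => //.
exact: (random_hrls_Q HRLSb 0 kappa mM).
Qed.

Lemma random_hrls_state alpha lambda (Tn : nat -> Omega -> 'cV[R]_D -> 'cV[R]_D)
    (x0 : Omega -> 'cV[R]_D) n :
  (forall k (z : Omega -> 'cV[R]_D), random_matrix z ->
     random_matrix (fun w => Tn k w (z w))) ->
  random_matrix x0 ->
  random_matrix (fun w => hrls_x alpha lambda (Tn ^~ w) (x0 w) n) /\
  random_matrix (fun w => hrls_xhalf alpha lambda (Tn ^~ w) (x0 w) n).
Proof.
move=> mT mx0.
have mrelax k (z : Omega -> 'cV[R]_D) : random_matrix z ->
    random_matrix (fun w => relax alpha (Tn k w) (z w)).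
  move=> mz; apply: random_matrixD; apply: random_matrixZ => //;
    try exact: measurable_cst; exact: mT.
elim: n => [|n [IHx IHxhalf]]; first by split => //; exact: mrelax.
have mx : random_matrix (fun w => hrls_x alpha lambda (Tn ^~ w) (x0 w) n.+1).
  under eq_fun do rewrite hrls_xS.
  exact: random_soft_threshold.
split=> //; under eq_fun do rewrite hrls_xhalfS.
by apply: random_matrixD; [apply: random_matrixB => //; exact: mrelax|exact: mT].
Qed.

Lemma measurable_energy (alpha : R) (U : 'M[R]_D) (xstar vstar : 'cV[R]_D)
    (x : nat -> Omega -> 'cV[R]_D) n :
  (forall k, random_matrix (x k)) ->
  measurable_fun [set: Omega] (fun w => energy alpha U xstar vstar (x ^~ w) n).
Proof.
move=> mx.
have my k : random_matrix (fun w => x k w - xstar).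
  by apply: random_matrixB => //; exact: random_matrix_cst.
have mUy k : random_matrix (fun w => U *m (x k w - xstar)).
  by apply: random_matrixM => //; exact: random_matrix_cst.
have mu : random_matrix (fun w => dual_var alpha U xstar (x ^~ w) n - vstar).
  apply: random_matrixB; last exact: random_matrix_cst.
  apply: random_matrixZ; first exact: measurable_cst.
  by apply: random_matrix_sum.
apply: measurable_funD; first apply: measurable_funB.
- exact: measurable_dotp.
- by apply: measurable_funM; [exact: measurable_cst|exact: measurable_dotp].
- by apply: measurable_funM; [exact: measurable_cst|exact: measurable_dotp].
Qed.

End hrls_measurability.
End measurability.

(** The sum defining v_0 is empty, so the initial energy is a function of x_0,
    which is measurable for every sigma-algebra F_n of the filtration. *)
Lemma energy0_sublevel (R : realType) d (Omega : measurableType d) D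
    (alpha : R) (U : 'M[R]_D) (xstar vstar : 'cV[R]_D)
    (x : nat -> Omega -> 'cV[R]_D) n M :
  sigma_vectors [set k | (k <= n)%N] x
    [set w | energy alpha U xstar vstar (x ^~ w) 0 <= M].
Proof.
rewrite /sigma_vectors /sigma_family; set G := (X in <<s X >>).
pose x' : g_sigma_algebraType G -> 'cV[R]_D := x 0%N.
have mx' : random_matrix x'.
  move=> i j _ B mB; rewrite setTI ord1; apply: sub_sigma_algebra.
  by exists (0%N, i) => //; exists B; rewrite ?setTI.
have mE := @measurable_energy _ _ _ _ alpha U xstar vstar (fun=> x') 0 (fun=> mx').
have := mE measurableT _ (measurable_itv `]-oo, M]); rewrite setTI.
suff -> : (fun w => energy alpha U xstar vstar (fun=> x' w) 0) @^-1` `]-oo, M] =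
  [set w | energy alpha U xstar vstar (x ^~ w) 0 <= M] by [].
apply/seteqP; split=> w /=; rewrite in_itv /= /energy /dual_var !big_geq //.
Qed.

(** * Summability of a nonnegative drift *)

Lemma nneseries_fin_num_cvg0 (R : realType) (u : nat -> R) :
  (forall n, 0 <= u n) -> (\sum_(0 <= n <oo) (u n)%:E)%E \is a fin_num ->
  u n @[n --> \oo] --> 0.
Proof.
move=> u0 ufin; apply: cvg_series_cvg_0; apply: nondecreasing_is_cvgn.
  by apply/nondecreasing_seqP => n; rewrite /series /= big_nat_recr //= lerDl.
exists (fine (\sum_(0 <= n <oo) (u n)%:E)%E) => _ [n _ <-].
rewrite -lee_fin fineK // -sumEFin; apply: nneseries_lim_ge => k _ _.
by rewrite lee_fin.
Qed.

Section drift.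
Context {R : realType} {d : measure_display} {Omega : measurableType d}.
Variable P : probability Omega R.

Section on_bounded_start.
Variables (V W th Z : nat -> Omega -> R) (psi : Omega -> R).
Variables (A : set Omega) (M : R).
Hypotheses (mA : measurable A)
  (mV : forall n, measurable_fun [set: Omega] (V n))
  (mW : forall n, measurable_fun [set: Omega] (W n))
  (V0 : forall n w, 0 <= V n w) (W0 : forall n w, 0 <= W n w)
  (drift : forall n w, V n.+1 w + W n w <= V n w + th n w)
  (AM : forall w, A w -> V 0%N w <= M)
  (ith : forall n, P.-integrable [set: Omega] (EFin \o th n))
  (iZ : forall n, P.-integrable [set: Omega] (EFin \o Z n))
  (thZ : forall n, (\int[P]_(w in A) (Z n w)%:E = \int[P]_(w in A) (th n w)%:E)%E)
  (mpsi : measurable_fun [set: Omega] psi) (psi0 : forall w, 0 <= psi w)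
  (psioo : (\int[P]_w (psi w)%:E < +oo)%E)
  (Zpsi : {ae P, forall w, (\sum_(0 <= n <oo) (Num.max 0 (Z n w))%:E <= (psi w)%:E)%E}).

Let mEFin (f : Omega -> R) :
  measurable_fun [set: Omega] f -> measurable_fun A (EFin \o f).
Proof. by move=> mf; apply/measurable_EFinP; exact: measurable_funTS. Qed.

Let iA (f : Omega -> R) :
  P.-integrable [set: Omega] (EFin \o f) -> P.-integrable A (EFin \o f).
Proof. exact: integrableS. Qed.

Let Zp n w := Num.max 0 (Z n w).

Let mZ n : measurable_fun [set: Omega] (Z n).
Proof. by apply/measurable_EFinP; exact: measurable_int (iZ n). Qed.

Let mZp n : measurable_fun [set: Omega] (Zp n).
Proof. by apply: measurable_maxr => //; exact: measurable_cst. Qed.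

Let Zp0 n w : 0 <= Zp n w.
Proof. by rewrite le_max lexx. Qed.

(* V_n is only known to be integrable on A: V_0 is bounded there, and V_{n+1}
   is dominated by V_n + th_n *)
Let iV n : P.-integrable A (EFin \o V n).
Proof.
elim: n => [|n IH].
  apply: (@le_integrable _ _ _ _ _ mA _ (EFin \o cst M)).
  - exact: mEFin.
  - move=> w Aw /=; rewrite lee_fin ger0_norm //.
    by apply: le_trans (AM Aw) _; exact: ler_norm.
  - apply: (integrableS measurableT) => //.
    exact: finite_measure_integrable_cst.
apply: (le_integrable mA _ _ (integrableD mA IH (iA (ith n)))).
  exact: mEFin.
move=> w Aw /=; rewrite lee_fin !ger0_norm //.
  by apply: le_trans (drift n w); rewrite lerDl.
by apply: le_trans (drift n w); rewrite addr_ge0.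
Qed.

Let step n : (\int[P]_(w in A) (W n w)%:E + \int[P]_(w in A) (V n.+1 w)%:E <=
  \int[P]_(w in A) (V n w)%:E + \int[P]_(w in A) (Zp n w)%:E)%E.
Proof.
rewrite addeC -ge0_integralD //; try exact: mEFin;
  try by move=> w _; rewrite lee_fin.
apply: (@le_trans _ _ (\int[P]_(w in A) ((V n w)%:E + (th n w)%:E))%E).
  apply: ge0_le_integral => //.
  - by move=> w _; rewrite -EFinD lee_fin addr_ge0.
  - by apply: emeasurable_funD; exact: mEFin.
  - apply: emeasurable_funD; first exact: mEFin.
    exact: measurable_int (iA (ith n)).
  - by move=> w _; rewrite -!EFinD lee_fin.
rewrite integralD //; [|exact: iV|exact: iA].
apply: leeD2l; rewrite -thZ; apply: le_integral => //; first exact: iA.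
  apply: (le_integrable mA _ _ (iA (iZ n))); first exact: mEFin.
  move=> w Aw /=; rewrite lee_fin ger0_norm // /Zp ge_max normr_ge0.
  exact: ler_norm.
by move=> w _; rewrite lee_fin le_max lexx orbT.
Qed.

Let sum_step n : (\sum_(0 <= k < n) \int[P]_(w in A) (W k w)%:E +
    \int[P]_(w in A) (V n w)%:E <=
  \int[P]_(w in A) (V 0%N w)%:E + \sum_(0 <= k < n) \int[P]_(w in A) (Zp k w)%:E)%E.
Proof.
elim: n => [|n IH]; first by rewrite !big_geq // add0e adde0.
rewrite !big_nat_recr //= -addeA.
apply: (@le_trans _ _ (\sum_(0 <= k < n) \int[P]_(w in A) (W k w)%:E +
  (\int[P]_(w in A) (V n w)%:E + \int[P]_(w in A) (Zp n w)%:E))%E).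
  by apply: leeD2l; exact: step.
by rewrite addeA [leRHS]addeA; apply: leeD2r.
Qed.

Let sum_Zp_le n : (\sum_(0 <= k < n) \int[P]_(w in A) (Zp k w)%:E <=
  \int[P]_w (psi w)%:E)%E.
Proof.
apply: (@le_trans _ _ (\sum_(0 <= k <oo) \int[P]_(w in A) (Zp k w)%:E)%E).
  apply: nneseries_lim_ge => k _ _.
  by apply: integral_ge0 => w _; rewrite lee_fin.
rewrite -integral_nneseries //; last 2 first.
- by move=> k; exact: mEFin.
- by move=> k w _; rewrite lee_fin.
apply: (@le_trans _ _ (\int[P]_(w in A) (psi w)%:E)%E); last first.
  apply: ge0_subset_integral => //; first exact/measurable_EFinP.
  by move=> w _; rewrite lee_fin.
apply: ae_ge0_le_integral => //.
- by move=> w _; apply: nneseries_ge0 => k _ _; rewrite lee_fin.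
- by apply: ge0_emeasurable_sum => [k w _ _|k _]; [rewrite lee_fin|exact: mEFin].
- by move=> w _; rewrite lee_fin.
- exact: mEFin.
- by apply: filterS Zpsi => w + _.
Qed.

(** Telescoping the drift inequality integrated over A bounds the partial sums
    of the integrals of W_n by the constant M + E psi; hence the series of the
    W_n is integrable on A, thus a.e. finite there. *)
Lemma drift_cvg0_on : {ae P, forall w, A w -> W n w @[n --> \oo] --> 0}.
Proof.
have W0e k w : A w -> (0 <= (W k w)%:E)%E by move=> _; rewrite lee_fin.
have iW : P.-integrable A (fun w => \sum_(0 <= k <oo) (W k w)%:E)%E.
  apply/integrableP; split.
    by apply: ge0_emeasurable_sum => [k w Aw _|k _]; [exact: W0e|exact: mEFin].
  have -> : (\int[P]_(w in A) `|\sum_(0 <= k <oo) (W k w)%:E| =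
      \sum_(0 <= k <oo) \int[P]_(w in A) (W k w)%:E)%E.
    rewrite -integral_nneseries //; last by move=> k; exact: mEFin.
    apply: eq_integral => w; rewrite inE => Aw; rewrite gee0_abs //.
    by apply: nneseries_ge0 => k _ _; exact: W0e.
  apply: (@le_lt_trans _ _
    (\int[P]_(w in A) (V 0%N w)%:E + \int[P]_w (psi w)%:E)%E).
    apply: lime_le.
      by apply: is_cvg_nneseries => k _ _; apply: integral_ge0 => w; exact: W0e.
    near=> n; apply: le_trans (leeD2l _ (sum_Zp_le n)).
    apply: le_trans (sum_step n); rewrite leeDl //.
    by apply: integral_ge0 => w _; rewrite lee_fin.
  by rewrite lte_add_pinfty //; have /integrable_lty := iV 0; exact.
have := integrable_ae mA iW; apply: filterS => w fw Aw.
by apply: nneseries_fin_num_cvg0 => //; exact: fw.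
Unshelve. all: by end_near. Qed.

End on_bounded_start.

(** The sublevel sets of V_0 are where the conditioning hypothesis relating Z to
    th is used.  They exhaust the space, which removes any integrability
    assumption on V_0. *)
Lemma drift_cvg0 (V W th Z : nat -> Omega -> R) (psi : Omega -> R) :
  (forall n, measurable_fun [set: Omega] (V n)) ->
  (forall n, measurable_fun [set: Omega] (W n)) ->
  (forall n w, 0 <= V n w) -> (forall n w, 0 <= W n w) ->
  (forall n w, V n.+1 w + W n w <= V n w + th n w) ->
  (forall n, P.-integrable [set: Omega] (EFin \o th n)) ->
  (forall n, P.-integrable [set: Omega] (EFin \o Z n)) ->
  (forall (M : R) n, let A := [set w | V 0%N w <= M] in
     (\int[P]_(w in A) (Z n w)%:E = \int[P]_(w in A) (th n w)%:E)%E) ->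
  measurable_fun [set: Omega] psi -> (forall w, 0 <= psi w) ->
  (\int[P]_w (psi w)%:E < +oo)%E ->
  {ae P, forall w, (\sum_(0 <= n <oo) (Num.max 0 (Z n w))%:E <= (psi w)%:E)%E} ->
  {ae P, forall w, W n w @[n --> \oo] --> 0}.
Proof.
move=> mV mW V0 W0 drift ith iZ thZ mpsi psi0 psioo Zpsi.
have on M : {ae P, forall w, [set w | V 0%N w <= M%:R] w -> W n w @[n --> \oo] --> 0}.
  apply: (drift_cvg0_on (M := M%:R) _ mV mW V0 W0 drift _ ith iZ _ mpsi psi0 psioo) => //.
  rewrite -[X in measurable X]setTI.
  have -> : [set w | V 0%N w <= M%:R] = V 0%N @^-1` `]-oo, M%:R].
    by apply/seteqP; split=> w /=; rewrite in_itv.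
  exact: mV.
have := ae_foralln on; apply: filterS => w /(_ (Num.bound (V 0%N w))); apply.
exact/ltW/archi_boundP/V0.
Qed.

End drift.

(** * The expected least-squares loss *)

Section has_mean.
Context {R : realType} {d : measure_display} {Omega : measurableType d}.
Variable P : probability Omega R.
Implicit Types (f g : Omega -> R) (c : R).

Definition has_mean f c : Prop :=
  P.-integrable [set: Omega] (EFin \o f) /\ ('E_P[f] = c%:E)%E.

(** An extended expectation of the form oo - oo is infinite by convention, so a
    finite value forces integrability. *)
Lemma has_mean_fin f c :
  measurable_fun [set: Omega] f -> ('E_P[f] = c%:E)%E -> has_mean f c.
Proof.
move=> mf fc; split=> //; have mEf : measurable_fun setT (EFin \o f).
  exact/measurable_EFinP.
apply/integrableP; split=> //; rewrite integral_fin_num_abs //.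
by move: fc; rewrite unlock => ->.
Qed.

Lemma has_mean_cst c : has_mean (cst c) c.
Proof.
by split; [exact: finite_measure_integrable_cst|exact: expectation_cst].
Qed.

Lemma has_meanD f g c e : has_mean f c -> has_mean g e ->
  has_mean (fun w => f w + g w) (c + e).
Proof.
move=> [fi fc] [gi ge]; split; first exact: (integrableD measurableT fi gi).
by move: fc ge; rewrite unlock => fc ge; rewrite (integralD measurableT fi gi) fc ge.
Qed.

Lemma has_meanZ f c k : has_mean f c -> has_mean (fun w => k * f w) (k * c).
Proof.
move=> [fi fc]; split; first exact: (integrableZl measurableT k fi).
by move: fc; rewrite unlock => fc; rewrite (integralZl measurableT fi) fc.
Qed.

Lemma has_mean_sum I (s : seq I) (f : I -> Omega -> R) (c : I -> R) :
  (forall i, has_mean (f i) (c i)) ->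
  has_mean (fun w => \sum_(i <- s) f i w) (\sum_(i <- s) c i).
Proof.
move=> fc; elim: s => [|i s IH].
  under eq_fun do rewrite big_nil; rewrite big_nil; exact: has_mean_cst.
under eq_fun do rewrite big_cons; rewrite big_cons; exact: has_meanD.
Qed.

Lemma has_mean_ge0 f c : has_mean f c -> (forall w, 0 <= f w) -> 0 <= c.
Proof. by move=> [_ fc] f0; rewrite -lee_fin -fc expectation_ge0. Qed.

Lemma has_mean_unique f c e : has_mean f c -> has_mean f e -> c = e.
Proof. by move=> [_ fc] [_]; rewrite fc => -[]. Qed.

End has_mean.

Section least_squares.
Context {R : realType} {d : measure_display} {Omega : measurableType d}.
Variables (P : probability Omega R) (D : nat).
Variables (MR : 'M[R]_D) (r : 'cV[R]_D) (sb : R).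

Section one_sample.
Variables (a : Omega -> 'cV[R]_D) (b : Omega -> R).
Hypotheses
  (hR : forall i j, has_mean P (fun w => a w i 0 * a w j 0) (MR i j))
  (hr : forall i, has_mean P (fun w => b w * a w i 0) (r i 0))
  (hb : has_mean P (fun w => b w ^+ 2) sb).

Lemma has_mean_dotp_sqr x :
  has_mean P (fun w => dotp (a w) x ^+ 2) (dotp x (MR *m x)).
Proof.
have -> : (fun w => dotp (a w) x ^+ 2) =
    (fun w => \sum_i \sum_j x i 0 * x j 0 * (a w i 0 * a w j 0)).
  apply/funext => w; rewrite expr2 /dotp mulr_suml; apply: eq_bigr => i _.
  by rewrite mulr_sumr; apply: eq_bigr => j _; ring.
have -> : dotp x (MR *m x) = \sum_i \sum_j x i 0 * x j 0 * MR i j.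
  apply: eq_bigr => i _; rewrite mxE mulr_sumr; apply: eq_bigr => j _; ring.
by do 2!apply: has_mean_sum => ?; exact: has_meanZ.
Qed.

Lemma has_mean_sqr_residual x : has_mean P (fun w => (dotp (a w) x - b w) ^+ 2)
  (dotp x (MR *m x) + (-2 * dotp x r + sb)).
Proof.
have -> : (fun w => (dotp (a w) x - b w) ^+ 2) = (fun w => dotp (a w) x ^+ 2 +
    (-2 * (\sum_i x i 0 * (b w * a w i 0)) + b w ^+ 2)).
  apply/funext => w; have -> : \sum_i x i 0 * (b w * a w i 0) = b w * dotp (a w) x.
    by rewrite mulr_sumr; apply: eq_bigr => i _; ring.
  ring.
apply: has_meanD; first exact: has_mean_dotp_sqr.
apply: has_meanD => //; apply: has_meanZ.
by apply: has_mean_sum => i; exact: has_meanZ.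
Qed.

Lemma second_moment_psd : psd MR.
Proof.
split; first apply/matrixP => i j; rewrite ?mxE.
  apply: (has_mean_unique (hR j i)); under eq_fun do rewrite mulrC; exact: hR.
by move=> x; apply: has_mean_ge0 (has_mean_dotp_sqr x) _ => w; exact: sqr_ge0.
Qed.

End one_sample.

Variables (a : nat -> Omega -> 'cV[R]_D) (b : nat -> Omega -> R).
Hypotheses
  (hR : forall n, (0 < n)%N -> forall i j,
     has_mean P (fun w => a n w i 0 * a n w j 0) (MR i j))
  (hr : forall n, (0 < n)%N -> forall i,
     has_mean P (fun w => b n w * a n w i 0) (r i 0))
  (hb : forall n, (0 < n)%N -> has_mean P (fun w => b n w ^+ 2) sb).

Lemma ls_lossE n x :
  ls_loss P a b n x = (n%:R * (dotp x (MR *m x) + (-2 * dotp x r + sb)))%:E.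
Proof.
rewrite /ls_loss; set q := (X in n%:R * X).
have [_ ->] : has_mean P (fun w => \sum_(1 <= k < n.+1) (dotp (a k w) x - b k w) ^+ 2)
    (\sum_(1 <= k < n.+1) q).
  under eq_fun do rewrite big_add1 /=; rewrite big_add1 /=.
  apply: has_mean_sum => k; apply: has_mean_sqr_residual;
    [exact: hR|exact: hr|exact: hb].
by rewrite sumr_const_nat subn1 /= mulr_natl.
Qed.

(** Completing the square, the loss exceeds its value at xstar by
    n <x - xstar, MR (x - xstar)>, which is n times the squared norm of
    MR^(1/2) (x - xstar). *)
Lemma argmin_ls_loss n xstar : (0 < n)%N -> psd MR -> MR \in unitmx ->
  MR *m xstar = r -> argmin (ls_loss P a b n) [set: 'cV[R]_D] = [set xstar].
Proof.
move=> n0 Mpsd uM Mx.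
have gap x : dotp x (MR *m x) + (-2 * dotp x r + sb) =
    dotp xstar (MR *m xstar) + (-2 * dotp xstar r + sb) +
    dotp (x - xstar) (MR *m (x - xstar)).
  rewrite -Mx mulmxBr !(dotpDl, dotpDr, dotpNl, dotpNr).
  have -> : dotp x (MR *m xstar) = dotp xstar (MR *m x).
    by rewrite dotpC (dotp_sym _ _ Mpsd.1).
  ring.
have leE x y : (ls_loss P a b n x <= ls_loss P a b n y)%E =
    (dotp (x - xstar) (MR *m (x - xstar)) <= dotp (y - xstar) (MR *m (y - xstar))).
  by rewrite !ls_lossE lee_fin ler_pM2l ?ltr0n // gap [leRHS]gap lerD2l.
apply/seteqP; split=> [x [_ /(_ xstar I)]|_ ->]; last first.
  split=> // y _; rewrite leE subrr mulmx0 [leLHS]big1 ?Mpsd.2 // => i _.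
  by rewrite mxE mul0r.
rewrite leE subrr mulmx0 [leRHS]big1 => [|i _]; last by rewrite mxE mul0r.
have [[Us _] UU] := psd_sqrtP Mpsd.
rewrite -{1}UU -mulmxA -(dotp_sym _ _ Us) => le0.
have /dotp_eq0 U0 : dotp (psd_sqrt MR *m (x - xstar)) (psd_sqrt MR *m (x - xstar)) = 0.
  by apply/eqP; rewrite eq_le le0 dotp_ge0.
apply/eqP; rewrite -subr_eq0; apply/eqP.
by rewrite -(mulKmx uM (x - xstar)) -UU -mulmxA U0 !mulmx0.
Qed.

End least_squares.

(** * Almost sure convergence *)

Theorem corollary1 (R : realType) (d : measure_display) (Omega : measurableType d)
  (P : probability Omega R) (D : nat)
  (* linear-regression model; index 0 of a, b, eta is unused *)
  (theta : 'cV[R]_D) (a : nat -> Omega -> 'cV[R]_D)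
  (b eta : nat -> {RV P >-> R})
  (ha : forall n, random_matrix (a n))
  (hmodel : forall n, (0 < n)%N ->
     {ae P, forall w, b n w = dotp (a n w) theta + eta n w})
  (heta0 : forall n, (0 < n)%N -> ('E_P[eta n] = 0)%E)
  (hindep : indep_sigma P (sigma_family [set n | (0 < n)%N] (fun n => eta n))
                          (sigma_vectors [set n | (0 < n)%N] a))
  (* second-order statistics, finite and independent of n *)
  (MR : 'M[R]_D) (r : 'cV[R]_D) (sb : R)
  (hR : forall n, (0 < n)%N -> forall i j,
     ('E_P[(fun w => a n w i 0 * a n w j 0)%R] = (MR i j)%:E)%E)
  (hr : forall n, (0 < n)%N -> forall i,
     ('E_P[(fun w => b n w * a n w i 0)%R] = (r i 0)%:E)%E)
  (hb : forall n, (0 < n)%N -> ('E_P[(fun w => b n w ^+ 2)%R] = sb%:E)%E)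
  (* initial values; constants are a special case *)
  (R0 : Omega -> 'M[R]_D) (r0 x0 : Omega -> 'cV[R]_D)
  (hR0 : random_matrix R0) (hr0 : random_matrix r0) (hx0 : random_matrix x0)
  (hR0psd : forall w, psd (R0 w))
  (* parameters *)
  (var : hrls_variant) (alpha lambda varpi kappa : R)
  (halpha : 2^-1 <= alpha < 1) (hlambda : 0 < lambda) (hkappa : 0 < kappa) :
  let Rn n w := sample_R (a ^~ w) (R0 w) n in
  let rn n w := sample_r (a ^~ w) (fun k => b k w) (r0 w) n in
  let Q := hrls_Q var varpi kappa MR in
  let ppi := hrls_pi var varpi kappa MR r in
  let T := affine_map Q ppi in
  let Qn n w := hrls_Q var varpi kappa (Rn n w) in
  let pin n w := hrls_pi var varpi kappa (Rn n w) (rn n w) in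
  let Tn n w := affine_map (Qn n w) (pin n w) in
  let x n w := hrls_x alpha lambda (Tn ^~ w) (x0 w) n in
  let xi n w := hrls_xi alpha lambda (Tn ^~ w) (x0 w) n in
  let F n := sigma_vectors [set k | (k <= n)%N] x in
  let U := psd_sqrt (1%:M - Q) in
  (* (i) *)
  {ae P, forall w, MR - Rn n w @[n --> \oo] --> (0 : 'M[R]_D)} ->
  {ae P, forall w, r - rn n w @[n --> \oo] --> (0 : 'cV[R]_D)} ->
  (* (ii) *)
  MR \in unitmx ->
  (* (iii) *)
  0 < varpi ->
  {ae P, forall w, forall n,
     Num.max (spectral_norm MR) (spectral_norm (Rn n w)) <= varpi} ->
  (* (iv) *)
  (forall xstar vstar : 'cV[R]_D, Upsilon lambda Q MR r (xstar, vstar) ->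
     let xistar := - (lambda^-1 *: (U *m vstar)) in
     let vtheta n w := vartheta alpha lambda Q T (Qn ^~ w) (Tn ^~ w)
                         (x ^~ w) (xi ^~ w) xstar xistar n in
     exists Z : nat -> Omega -> R,
       (forall n, is_cond_exp P (F n) (vtheta n) (Z n)) /\
       exists psi : {RV P >-> R},
         [/\ forall w, 0 <= psi w,
             ('E_P[psi] < +oo)%E &
             {ae P, forall w,
                (\sum_(0 <= n <oo) (Num.max 0 (Z n w))%:E <= (psi w)%:E)%E}]) ->
  (* (v) *)
  (exists2 C : R, 0 < C &
     forall n, ('E_P[(fun w => norm2 (pin n w - ppi) ^+ 2)%R] <= C%:E)%E) ->
  {ae P, forall w,
     cluster (x n w @[n --> \oo]) !=set0 /\
     forall z, cluster (x n w @[n --> \oo]) z ->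
       forall n, (0 < n)%N ->
         argmin (norm1 : 'cV[R]_D -> R)
           (argmin (ls_loss P a (fun k => b k) n) [set: 'cV[R]_D]) z}.
Proof.
move=> Rn rn Q ppi T Qn pin Tn x xi F U _ _ uM varpi0 hnorm hcond _.
have mb k : measurable_fun [set: Omega] (b k) by [].
have mab n i j : measurable_fun [set: Omega] (fun w => a n w i 0 * a n w j 0).
  by apply: measurable_funM; exact: ha.
have hR' n (n0 : (0 < n)%N) i j : has_mean P (fun w => a n w i 0 * a n w j 0) (MR i j).
  by apply: has_mean_fin => //; exact: hR.
have hr' n (n0 : (0 < n)%N) i : has_mean P (fun w => b n w * a n w i 0) (r i 0).
  apply: has_mean_fin; last exact: hr.
  by apply: measurable_funM => //; exact: ha.
have hb' n (n0 : (0 < n)%N) : has_mean P (fun w => b n w ^+ 2) sb.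
  by apply: has_mean_fin; [exact: measurable_funX|exact: hb].
have Mpsd := second_moment_psd (hR' 1%N isT).
pose xstar := invmx MR *m r.
have Mx : MR *m xstar = r by rewrite mulKVmx.
have Mvarpi : spectral_norm MR <= varpi.
  have PT : (0 < P [set: Omega])%E by rewrite probability_setT lte01.
  (* one sample point satisfying the almost sure bound is enough *)
  have aeP := ae_properfilter_algebraOfSetsType PT.
  by have [w /(_ 0%N)] := filter_ex hnorm; rewrite ge_max => /andP[].
have Tx : T xstar = xstar by apply: hrls_fixed_point.
have [[Us _] UU] : psd U /\ U *m U = 1%:M - Q.
  by apply: psd_sqrtP; exact: one_sub_hrls_Q_psd.
have uU : U \in unitmx.
  have : U *m U \in unitmx by rewrite UU one_sub_hrls_Q_unit.
  by rewrite unitmx_mul => /andP[].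
have UleI z : dotp (U *m z) (U *m z) <= dotp z z.
  rewrite (dotp_sym _ _ Us) mulmxA UU mulmxBl mul1mx dotpDr dotpNr.
  by rewrite gerBl hrls_Q_ge0.
have l0 : lambda != 0 by rewrite gt_eqF.
have alN1 : alpha != 1 by rewrite lt_eqF //; case/andP: halpha.
have [al0 al1] : 0 <= alpha /\ alpha < 1.
  by case/andP: halpha => h1 ->; split=> //; apply: le_trans h1; rewrite invr_ge0.
pose s : 'cV[R]_D := \col_i Num.sg (xstar i 0).
(* vstar is chosen so that xistar is the sign vector of xstar *)
pose vstar := - (lambda *: (invmx U *m s)).
have sE : - (lambda^-1 *: (U *m vstar)) = s.
  by rewrite mulmxN -scalemxAr mulKVmx // scalerN scalerA mulVf // scale1r opprK.
have Ups : Upsilon lambda Q MR r (xstar, vstar).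
  by split=> //=; rewrite -/U sE; exact: sign_subdiff.
have [Z [hZ [psi [psi0 psioo Zpsi]]]] := hcond _ _ Ups.
have mT k (z : Omega -> 'cV[R]_D) : random_matrix z ->
    random_matrix (fun w => Tn k w (z w)).
  move=> mz; have mRn := random_sample_R k ha hR0.
  apply: random_matrixD.
    by apply: random_matrixM => //; exact: random_hrls_Q.
  by apply: random_hrls_pi => //; exact: random_sample_r.
have mx n : random_matrix (x n) by have [] := random_hrls_state alpha lambda n mT hx0.
pose V n w := energy alpha U xstar vstar (x ^~ w) n.
pose W n w := (3 * alpha - 1) *
  dotp (U *m (x n.+1 w - xstar)) (U *m (x n.+1 w - xstar)).
have al3 : 0 < 3 * alpha - 1 by case/andP: halpha; lra.
have W0 : {ae P, forall w, W n w @[n --> \oo] --> 0}.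
  apply: (@drift_cvg0 _ _ _ P V W (fun n w => vartheta alpha lambda Q T (Qn ^~ w)
    (Tn ^~ w) (x ^~ w) (xi ^~ w) xstar (- (lambda^-1 *: (U *m vstar))) n) Z psi).
  - by move=> n; exact: measurable_energy.
  - move=> n; apply: measurable_funM; first exact: measurable_cst.
    by apply: measurable_dotp; apply: random_matrixM; try exact: random_matrix_cst;
      apply: random_matrixB => //; exact: random_matrix_cst.
  - by move=> n w; apply: energy_ge0 => //; rewrite al0.
  - by move=> n w; rewrite mulr_ge0 ?dotp_ge0 // ltW.
  - move=> n w.
    rewrite -(energy_identity (Tn := Tn ^~ w) (pn := pin ^~ w) (x0 w) vstar n
      (fun _ _ => erefl) alN1 l0 Us UU Tx).
    rewrite /V lerD2l lerDl subr_ge0.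
    by apply: le_trans (UleI _); rewrite ler_piMl ?dotp_ge0 // ltW.
  - by move=> n; have [] := hZ n.
  - by move=> n; have [] := hZ n.
  - by move=> M n; have [_ _ _] := hZ n; apply; exact: energy0_sublevel.
  - by [].
  - exact: psi0.
  - by move: psioo; rewrite unlock.
  - exact: Zpsi.
apply: filterS W0 => w W0.
have xcvg : x n w @[n --> \oo] --> xstar.
  rewrite -cvg_shiftS; apply: (cvg_of_quadratic uU).
  have -> : (fun n => dotp (U *m (x n.+1 w - xstar)) (U *m (x n.+1 w - xstar))) =
      (fun n => (3 * alpha - 1)^-1 * W n w).
    by apply/funext => n; rewrite /W mulKf // gt_eqF.
  rewrite -[X in _ --> X](mulr0 (3 * alpha - 1)^-1).
  by apply: cvgM => //; exact: cvg_cst.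
rewrite (cluster_cvg_eq xcvg); split; first by exists xstar.
move=> _ -> n n0; rewrite (argmin_ls_loss hR' hr' hb' n0 Mpsd uM Mx).
by split=> // _ ->.
Qed.
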